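(* Let $k\ge 0$ be an integer and $n=2^{k+3}$. Then there exist two trees $T_1,T_2$ of order $n$ that are incomparable with respect to $\preceq$, i.e. neither $T_1\preceq T_2$ nor $T_2\preceq T_1$ holds.
   Context: All graphs are finite, simple and undirected. The independence polynomial of a graph $G$ is $I(G,x)=\sum_{k\ge 0} i_kx^k$, where $i_k$ is the number of independent sets of size $k$ in $G$. It is known that the root of $I(G,x)$ of smallest modulus is real and lies in $[-1,0)$; it is denoted $\xi(G)$ (equivalently, the largest real root of $I(G,x)$). For graphs $G,H$, write $H\preceq G$ if and only if $I(H,x)\ge I(G,x)$ for all $x\in[\xi(G),0]$. *)

(* Defs.v *)
From mathcomp Require Import all_boot all_order all_algebra.
From mathcomp Require Import boolp classical_sets reals.
From mathcomp Require Import complex.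

Set Implicit Arguments.
Unset Strict Implicit.
Unset Printing Implicit Defensive.

Import Order.TTheory GRing.Theory Num.Theory.
Local Open Scope ring_scope.

Record sgraph := SGraph {
  vertex :> finType;
  adj : rel vertex;
  adj_sym : symmetric adj;
  adj_irrefl : irreflexive adj
}.

Definition graph_order (G : sgraph) : nat := #|G|.

Definition connected_graph (G : sgraph) : Prop :=
  (0 < #|G|)%N /\ forall x y : G, connect (@adj G) x y.

(* [ucycle] also accepts the empty sequence and a single edge traversed back
   and forth, hence the bound on the length. *)
Definition acyclic_graph (G : sgraph) : Prop :=
  forall c : seq G, (2 < size c)%N -> ~ ucycle (@adj G) c.

Definition is_tree (G : sgraph) : Prop := connected_graph G /\ acyclic_graph G.

Definition independent (G : sgraph) (A : {set G}) : bool :=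
  [forall x in A, forall y in A, ~~ adj x y].

Definition num_indep (G : sgraph) (k : nat) : nat :=
  #|[set A : {set G} | independent A & #|A| == k]|.

Definition indep_poly (R : nzRingType) (G : sgraph) : {poly R} :=
  \poly_(k < #|G|.+1) (num_indep G k)%:R.

(* A real root of I(G, x) whose modulus is minimal among all complex roots. It
   is unique: the coefficients of I(G, x) are nonnegative and I(G, 0) = 1, so a
   real root is negative and is determined by its modulus. *)
Definition smallest_modulus_root (R : realType) (G : sgraph) (z : R) : Prop :=
  root (indep_poly R G) z /\
  forall w : R[i], root (indep_poly R[i] G) w -> `|z%:C%C| <= `|w|.

(* Such a root exists as soon as G has a vertex; the default value 0 is only
   reached for the graph without vertices, where I(G, x) = 1. *)
Definition xi (R : realType) (G : sgraph) : R :=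
  xget 0 [set z : R | smallest_modulus_root G z]%classic.

Definition preceq (R : realType) (H G : sgraph) : Prop :=
  forall x : R, xi R G <= x <= 0 ->
    (indep_poly R G).[x] <= (indep_poly R H).[x].

(* Main.v *)
(* Attach a pendant vertex to each vertex of a tree T on n vertices. The result is
   a tree T' on 2n vertices with I(T', x) = (1 + x)^n I(T, x / (1 + x)), and
   x |-> x / (1 + x) is increasing with inverse x |-> x / (1 - x). Hence
   xi(T') = xi(T) / (1 - xi(T)), and incomparable trees yield incomparable trees.
   It remains to find an incomparable pair on 8 vertices. The comb (three times
   this operation applied to one vertex) has polynomial
   P = (1 + x)^2 (1 + 2x) (1 + 4x), so its xi is -1/4; the star K_{1,3} with its
   centre joined to an end of the path P_4 has polynomial
   Q = 1 + 8x + 21x^2 + 23x^3 + 13x^4 + 3x^5, whose xi is below -1/4. Then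
   P(-1/4) = 0 < Q(-1/4), while Q(-1/5) < P(-1/5). *)
Require Import Defs.
From mathcomp Require Import all_boot all_order all_algebra.
From mathcomp Require Import boolp classical_sets reals.
From mathcomp Require Import complex.
From mathcomp Require Import ring lra.

Set Implicit Arguments.
Unset Strict Implicit.
Unset Printing Implicit Defensive.

Import Order.TTheory GRing.Theory Num.Theory.
Local Open Scope ring_scope.

(** * Trees with pendant vertices attached *)

Section Pendant.
Variables (G : sgraph) (L : finType) (f : L -> G).

(** [f] sends each new leaf to its neighbour; it need not be injective, so several leaves can share
    one. *)
Definition pendant_rel : rel (G + L)%type := fun u v =>
  match u, v with
  | inl x, inl y => adj x y
  | inl x, inr l | inr l, inl x => f l == x
  | inr _, inr _ => false
  end.

Lemma pendant_sym : symmetric pendant_rel.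
Proof. by case=> [x|l] [y|m] //=; rewrite adj_sym. Qed.

Lemma pendant_irrefl : irreflexive pendant_rel.
Proof. by case=> [x|l] //=; rewrite adj_irrefl. Qed.

Definition pendant : sgraph := SGraph pendant_sym pendant_irrefl.

Lemma order_pendant : graph_order pendant = (graph_order G + #|L|)%N.
Proof. exact: card_sum. Qed.

Lemma pendant_connected : connected_graph G -> connected_graph pendant.
Proof.
case=> G0 cG; split; first by rewrite -/(graph_order _) order_pendant addn_gt0 G0.
have cl (x y : G) : connect (@adj pendant) (inl x) (inl y).
  have /connectP[p pp ->] := cG x y.
  apply/connectP; exists (map inl p); last by rewrite last_map.
  by rewrite path_map.
have toG (u : pendant) : exists x : G,
    connect (@adj pendant) u (inl x) /\ connect (@adj pendant) (inl x) u.
  case: u => [x|l]; first by exists x.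
  by exists (f l); split; apply: connect1 => /=; rewrite eqxx.
move=> u v; have [x [ux _]] := toG u; have [y [_ yv]] := toG v.
exact: connect_trans ux (connect_trans (cl x y) yv).
Qed.

(** A leaf has a single neighbour, while on a cycle its predecessor and successor differ; so a cycle
    avoids the leaves and lies in [G]. *)
Lemma pendant_acyclic : acyclic_graph G -> acyclic_graph pendant.
Proof.
move=> aG c szc /andP[cyc uc].
have noL l : inr l \notin c.
  apply/negP => /rot_to[i s rc].
  have : ucycle (@adj pendant) (inr l :: s).
    by rewrite -rc /ucycle rot_cycle rot_uniq; apply/andP.
  have : (2 < size (inr l :: s : seq pendant))%N by rewrite -rc size_rot.
  case: s {rc} => [|x s] //; case/lastP: s => [|s y] //= _.
  rewrite /ucycle /= rcons_path last_rcons => /andP[/andP[ax /andP[_ ay]]].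
  move=> /and3P[_ + _]; rewrite mem_rcons in_cons negb_or => /andP[+ _].
  by case: x ax => // x /eqP <-; case: y ay => // y /eqP <-; rewrite eqxx.
have [c' cE] : exists c' : seq G, c = map inl c'.
  elim: c noL {szc cyc uc} => [|u c IHc] noL; first by exists [::].
  have [l|c' ->] := IHc; first by have := noL l; rewrite inE negb_or => /andP[].
  case: u noL => [x _|l noL]; first by exists (x :: c').
  by have := noL l; rewrite mem_head.
apply: (aG c'); first by move: szc; rewrite cE size_map.
move: cyc uc; rewrite cE map_inj_uniq; last by move=> ? ? [].
by rewrite /ucycle cycle_map => cyc ->; rewrite andbT.
Qed.

Lemma pendant_tree : is_tree G -> is_tree pendant.
Proof. by case=> ? ?; split; [apply: pendant_connected|apply: pendant_acyclic]. Qed.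

End Pendant.

(** * Weighted sums over independent sets *)

(* With a = x and b = 1 this is I(G, x). Keeping a weight on the vertices outside
   the independent set makes the effect of pendant vertices division-free. *)
Definition hard_core (F : comNzRingType) (G : sgraph) (a b : G -> F) : F :=
  \sum_(A : {set G} | independent A) \prod_v (if v \in A then a v else b v).

Lemma independentP (G : sgraph) (A : {set G}) :
  reflect {in A &, forall x y, ~~ adj x y} (independent A).
Proof.
apply: (iffP forall_inP) => [h x y xA yA|h x xA].
  by move/forall_inP: (h x xA) => /(_ y yA).
by apply/forall_inP => y yA; apply: h.
Qed.

(** Once the trace on [G] is fixed, each leaf chooses freely, except that a leaf over a chosen
    vertex stays out; so the sum over leaf sets factors. *)
Lemma hard_core_pendant (F : comNzRingType) (G : sgraph) (L : finType)
    (f : L -> G) (a b : pendant f -> F) :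
  hard_core a b =
  hard_core (fun v => a (inl v) * \prod_(l | f l == v) b (inr l))
            (fun v => b (inl v) * \prod_(l | f l == v) (a (inr l) + b (inr l))).
Proof.
pose join (p : {set G} * {set L}) : {set pendant f} :=
  [set u | match u with inl x => x \in p.1 | inr l => l \in p.2 end].
pose split (A : {set pendant f}) : {set G} * {set L} :=
  ([set x | inl x \in A], [set l | inr l \in A]).
have joinK : cancel join split.
  by move=> [A B]; congr pair; apply/setP => x; rewrite !inE.
have splitK : cancel split join.
  by move=> A; apply/setP; case=> x; rewrite !inE.
rewrite /hard_core (reindex join) /=; last by exists split => ? _.
(* Weight 0 for a chosen leaf over [A] encodes independence, so [B] can range over all subsets. *)
transitivity (\sum_(A : {set G} | independent A) \sum_(B : {set L})
   (\prod_v (if v \in A then a (inl v) else b (inl v)) *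
    \prod_l (if l \in B then (if f l \in A then 0 else a (inr l)) else b (inr l)))).
  rewrite pair_big_dep /= [LHS]big_mkcond [RHS]big_mkcond /=.
  apply: eq_bigr => -[A B] _ /=; rewrite andbT big_sumType /=.
  have -> : independent (join (A, B)) =
      independent A && [forall l in B, f l \notin A].
    apply/independentP/andP => [h|[/independentP hA /forall_inP hB]].
      split.
        apply/independentP => x y xA yA.
        by apply: (h (inl x) (inl y)); rewrite inE.
      apply/forall_inP => l lB; apply/negP => flA.
      by have := h (inl (f l)) (inr l); rewrite !inE /= eqxx => /(_ flA lB).
    case=> [x|l] [y|m]; rewrite !inE //= => h1 h2.
    - exact: hA.
    - by apply: contraNneq (hB m h2) => ->.
    - by apply: contraNneq (hB l h1) => ->.
  case: ifP => [/andP[-> /forall_inP hB]|].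
    congr (_ * _); first by apply: eq_bigr => v _; rewrite inE.
    apply: eq_bigr => l _; rewrite inE /=; case: ifP => // lB.
    by rewrite (negPf (hB l lB)).
  case: (independent A) => //= /negbT /forall_inPn[l lB].
  rewrite negbK => flA.
  by rewrite (bigD1 l (F := fun l => if _ then _ else _)) //= lB flA mul0r mulr0.
apply: eq_bigr => A iA; rewrite -big_distrr /= -bigA_distr /=.
have -> : \prod_l ((if f l \in A then 0 else a (inr l)) + b (inr l)) =
   \prod_v \prod_(l | f l == v)
      (if v \in A then b (inr l) else a (inr l) + b (inr l)).
  rewrite [LHS](partition_big f predT) //=.
  apply: eq_bigr => v _; apply: eq_bigr => l /eqP ->.
  by case: ifP; rewrite ?add0r.
by rewrite -big_split /=; apply: eq_bigr => v _; case: ifP.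
Qed.

Lemma horner_indep_poly (F : comNzRingType) (G : sgraph) (x : F) :
  (indep_poly F G).[x] = hard_core (fun _ : G => x) (fun=> 1).
Proof.
have prodE (A : {set G}) : \prod_v (if v \in A then x else 1) = x ^+ #|A|.
  by rewrite -big_mkcond prodr_const.
rewrite /hard_core; under eq_bigr do rewrite prodE.
rewrite /indep_poly horner_poly.
rewrite (partition_big (fun A : {set G} => inord #|A| : 'I_#|G|.+1) predT) //=.
apply: eq_bigr => k _.
have cE (A : {set G}) : (inord #|A| == k) = (#|A| == k :> nat).
  by rewrite -val_eqE /= inordK // ltnS max_card.
under eq_bigr => A /andP[_ /eqP Ak].
  have /eqP -> : #|A| == k by rewrite -cE Ak. over.
rewrite sumr_const mulr_natl; congr (_ *+ _).
by rewrite /num_indep; apply: eq_card => A; rewrite !inE [RHS]inE cE.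
Qed.

Definition corona (G : sgraph) : sgraph := pendant (@id G).

(** A vertex with its leaf weighs [x] if chosen and [1 + x] otherwise; factor out [1 + x]. *)
Lemma horner_corona (F : fieldType) (G : sgraph) (x : F) : 1 + x != 0 ->
  (indep_poly F (corona G)).[x] =
  (1 + x) ^+ #|G| * (indep_poly F G).[x / (1 + x)].
Proof.
move=> x1; rewrite !horner_indep_poly hard_core_pendant /hard_core big_distrr /=.
apply: eq_bigr => A _; rewrite -prodr_const -big_split /=.
apply: eq_bigr => v _; case: ifP => _.
  rewrite big1 // mulr1 mulrCA divff ?mulr1 //.
by rewrite big_pred1_eq mul1r mulr1 addrC.
Qed.

(** * Smallest-modulus roots and their transport to the corona *)

Section SmallestRoot.
Variable R : realType.
Implicit Types (G H : sgraph) (x z : R) (w : R[i]).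

Local Notation normc := (@Normc.normc R).

Lemma normc_real x : normc x%:C%C = `|x|.
Proof. by rewrite /Normc.normc /= expr0n addr0 sqrtr_sqr. Qed.

Lemma normc_ge0 w : 0 <= normc w.
Proof. by case: w => ? ?; rewrite sqrtr_ge0. Qed.

Lemma normc_opp w : normc (- w) = normc w.
Proof. exact: normcN. Qed.

Lemma lerB_normcD u v : normc u - normc v <= normc (u + v).
Proof.
rewrite lerBlDr -{1}[u](addrK v) -(normc_opp v).
exact: le_normcD (u + v) (- v).
Qed.

Lemma indep_poly_gt0 G x : 0 <= x -> 0 < (indep_poly R G).[x].
Proof.
move=> x0; rewrite horner_indep_poly /hard_core (bigD1 finset.set0) /=; last first.
  by apply/independentP => u v; rewrite inE.
rewrite big1 => [|v _]; last by rewrite inE.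
rewrite ltr_pwDl // sumr_ge0 // => A _; apply: prodr_ge0 => v _.
by case: ifP.
Qed.

Lemma smallest_rootP G z : smallest_modulus_root G z <->
  [/\ z < 0, root (indep_poly R G) z &
      forall w, root (indep_poly R[i] G) w -> - z <= normc w].
Proof.
split=> [[rz hz]|[z0 rz hz]].
  have z0 : z < 0.
    by rewrite ltNge; apply/negP => /(indep_poly_gt0 G); rewrite (rootP rz) ltxx.
  split=> // w /hz.
  by rewrite -(ltr0_norm z0) -normc_real -lecR.
split=> // w /hz.
by rewrite -(ltr0_norm z0) -normc_real -lecR.
Qed.

(** Two such roots are both complex roots, so each bounds the modulus of the other; both being
    negative, they coincide. *)
Lemma xiE G z : smallest_modulus_root G z -> xi R G = z.
Proof.
move=> hz; have : smallest_modulus_root G (xi R G).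
  exact: (xgetPex 0 (ex_intro _ z hz)).
have real_root x : root (indep_poly R G) x -> root (indep_poly R[i] G) x%:C%C.
  have -> : indep_poly R[i] G = map_poly (real_complex R) (indep_poly R G).
    apply/polyP => i; rewrite coef_map !coef_poly.
    case: ifP => _; last by rewrite raddf0.
    exact: esym (rmorph_nat (real_complex R) _).
  by move=> rx; rewrite rmorph_root.
move: hz => /smallest_rootP[z0 rz hz] /smallest_rootP[x0 rx hx].
have := hz _ (real_root _ rx); have := hx _ (real_root _ rz).
rewrite !normc_real !ltr0_norm // !lerN2 => zx xz.
by apply/le_anti/andP.
Qed.

(** For a root w other than -1, w / (1 + w) is a root for [G], so |w| >= |z| |1 + w| >= |z| (1 -
    |w|), that is |w| >= |z| / (1 + |z|). *)
Lemma smallest_root_corona G z :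
  smallest_modulus_root G z -> smallest_modulus_root (corona G) (z / (1 - z)).
Proof.
move=> /smallest_rootP[z0 rz hz]; apply/smallest_rootP.
have z1 : 1 - z > 0 by lra.
have z1' : 1 - z != 0 by rewrite gt_eqF.
have e1 : 1 + z / (1 - z) = (1 - z)^-1 by field.
split; first by rewrite ltr_pdivrMr // mul0r.
  rewrite /root horner_corona e1 ?invr_eq0 // invrK divfK //.
  by rewrite (rootP rz) mulr0.
move=> w; rewrite -mulNr ler_pdivrMr //.
have [w1 _|w1] := eqVneq (1 + w) 0.
  have -> : w = - 1 by apply/eqP; rewrite -addr_eq0 addrC w1.
  rewrite normc_opp Normc.normc1; lra.
rewrite /root horner_corona // mulf_eq0 expf_eq0 (negPf w1) andbF /= => /hz hy.
have wE : normc w = normc (w / (1 + w)) * normc (1 + w).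
  by rewrite -Normc.normcM divfK.
have := lerB_normcD 1 w; rewrite Normc.normc1.
move: wE (normc_ge0 w) hy; move: (normc (w / _)) (normc (1 + w)) (normc w).
move=> s t m mE m0 zs tm.
have [m1|m1] := leP 1 m; nra.
Qed.

(** The map x / (1 - x) carries [xi(G), 0] into [xi(corona G), 0], and equal orders make the
    positive factor (1 - x)^-n common to both sides. *)
Lemma preceq_corona G H z : smallest_modulus_root G z ->
  graph_order H = graph_order G -> preceq R (corona H) (corona G) ->
  preceq R H G.
Proof.
move=> hz oHG hc x; rewrite (xiE hz) => /andP[zx x0].
have [z0 _ _] := (smallest_rootP _ _).1 hz.
have x1 : 1 - x > 0 by lra.
have x1' : 1 - x != 0 by rewrite gt_eqF.
have e1 : 1 + x / (1 - x) = (1 - x)^-1 by field.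
have := hc (x / (1 - x)); rewrite (xiE (smallest_root_corona hz)).
rewrite !horner_corona e1 ?invr_eq0 // invrK divfK //.
move: oHG; rewrite /graph_order => ->; rewrite ler_pM2l ?exprn_gt0 ?invr_gt0 //.
apply; rewrite mulr_le0_ge0 ?invr_ge0 ?(ltW x1) // andbT.
by rewrite ler_pdivrMr 1?mulrAC ?ler_pdivlMr //; lra.
Qed.

End SmallestRoot.

Lemma order_corona G : graph_order (corona G) = (2 * graph_order G)%N.
Proof. by rewrite order_pendant mul2n -addnn. Qed.

(** * The single vertex and the comb on 8 vertices *)

Definition K1 : sgraph :=
  @SGraph unit (fun _ _ => false) (fun _ _ => erefl) (fun _ => erefl).

Lemma K1_tree : is_tree K1.
Proof.
split; first by split; [rewrite card_unit|case=> -[]; apply: connect0].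
move=> c szc /andP[_ /card_uniqP uc].
by have := max_card (mem c); rewrite uc card_unit leqNgt (ltnW szc).
Qed.

Lemma hard_core_K1 (F : comNzRingType) (a b : K1 -> F) :
  hard_core a b = a tt + b tt.
Proof.
rewrite /hard_core (eq_bigl predT) => [|A]; last by apply/independentP.
by rewrite -bigA_distr (big_pred1 tt) //; case.
Qed.

Lemma smallest_root_K1 (R : realType) : smallest_modulus_root K1 (-1 : R).
Proof.
have e (F : comNzRingType) (x : F) : (indep_poly F K1).[x] = x + 1.
  by rewrite horner_indep_poly hard_core_K1.
apply/smallest_rootP; split; first by lra.
  by rewrite /root e addNr.
move=> w; rewrite /root e addr_eq0 => /eqP ->.
by rewrite normc_opp Normc.normc1 opprK.
Qed.

Definition comb8 : sgraph := corona (corona (corona K1)).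

Lemma comb8_tree : is_tree comb8.
Proof. by do 3!apply: pendant_tree; apply: K1_tree. Qed.

Lemma order_comb8 : graph_order comb8 = 8.
Proof. by rewrite !order_corona /graph_order card_unit. Qed.

Lemma smallest_root_comb8 (R : realType) :
  smallest_modulus_root comb8 (- 4^-1 : R).
Proof.
(* The root moves through -1, -1/2, -1/3, -1/4. *)
have -> : - 4^-1 = let s (z : R) := z / (1 - z) in s (s (s (-1))).
  by rewrite /=; field.
by do 3!apply: smallest_root_corona; apply: smallest_root_K1.
Qed.

Lemma horner_comb8_at (R : realType) :
  (indep_poly R comb8).[- 5^-1] = 48 / 625.
Proof.
rewrite horner_corona; last by apply: lt0r_neq0; lra.
have -> : (- 5^-1 : R) / (1 + - 5^-1) = - 4^-1 by field.
rewrite horner_corona; last by apply: lt0r_neq0; lra.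
have -> : (- 4^-1 : R) / (1 + - 4^-1) = - 3^-1 by field.
rewrite horner_corona; last by apply: lt0r_neq0; lra.
have -> : (- 3^-1 : R) / (1 + - 3^-1) = - 2^-1 by field.
have := order_corona (corona K1); have := order_corona K1.
rewrite /graph_order card_unit => -> ->.
by rewrite horner_indep_poly hard_core_K1; field.
Qed.

(** * The star joined to a path *)

(* The centre of the star K_{1,3} is the vertex [inr true] of the path with five
   vertices, whose other four vertices form the path P_4. *)
Definition starred_path3 : sgraph := @pendant K1 bool (fun=> tt).
Definition starred_path5 : sgraph := @pendant starred_path3 bool inr.
Definition starred_path : sgraph :=
  @pendant starred_path5 'I_3 (fun=> inr true).

Lemma horner_starred_path (F : comNzRingType) (x : F) :
  (indep_poly F starred_path).[x] =
  1 + 8 * x + 21 * x ^+ 2 + 23 * x ^+ 3 + 13 * x ^+ 4 + 3 * x ^+ 5.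
Proof.
have prod_bool (P : pred bool) (E : bool -> F) : \prod_(b | P b) E b =
    (if P true then E true else 1) * (if P false then E false else 1).
  by rewrite big_mkcond big_bool.
have prod3 (b : bool) (y : F) :
    \prod_(l < 3 | b) y = if b then y ^+ 3 else 1.
  by case: b; rewrite ?big_pred0_eq // prodr_const card_ord.
rewrite horner_indep_poly !hard_core_pendant hard_core_K1.
rewrite 2!prod_bool /=.
rewrite !prod_bool /= !prod3 /=.
ring.
Qed.

Lemma starred_path_tree : is_tree starred_path.
Proof. by do 3!apply: pendant_tree; apply: K1_tree. Qed.

Lemma order_starred_path : graph_order starred_path = 8.
Proof.
by rewrite !order_pendant !card_bool card_ord /graph_order card_unit.
Qed.

Lemma starred_path_poly_incr (R : realType) (x y : R) :
  - (26 / 100) <= x -> x < y -> y <= 0 ->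
  (indep_poly R starred_path).[x] < (indep_poly R starred_path).[y].
Proof.
move=> xl xy y0; rewrite !horner_starred_path -subr_gt0.
set d := (X in 0 < X).
have -> : d = (y - x) * (8 + 21 * (x + y) + 23 * (x ^+ 2 + x * y + y ^+ 2)
   + 13 * (x + y) * (x ^+ 2 + y ^+ 2)
   + 3 * (x ^+ 4 + x ^+ 3 * y + x ^+ 2 * y ^+ 2 + x * y ^+ 3 + y ^+ 4)).
  by rewrite /d; ring.
apply: mulr_gt0; first by lra.
have xy0 : 0 <= x * y by rewrite mulr_le0 //; lra.
have quad : 3 / 4 * (x + y) ^+ 2 <= x ^+ 2 + x * y + y ^+ 2.
  by have := sqr_ge0 (x - y); lra.
(* x^2 + y^2 is at most 2 * 0.26^2 < 14/100, and [x + y <= 0] reverses the inequality. *)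
have cube : 14 / 100 * (x + y) <= (x + y) * (x ^+ 2 + y ^+ 2).
  rewrite [_ * (x + y)]mulrC; apply: ler_wnM2l; first by lra.
  nra.
have quart : 0 <= x ^+ 4 + x ^+ 3 * y + x ^+ 2 * y ^+ 2 + x * y ^+ 3 + y ^+ 4.
  have -> : x ^+ 4 + x ^+ 3 * y + x ^+ 2 * y ^+ 2 + x * y ^+ 3 + y ^+ 4 =
      x ^+ 4 + y ^+ 4 + x * y * (x ^+ 2 + x * y + y ^+ 2) by ring.
  have h (u : R) : 0 <= u ^+ 4 by apply: exprn_even_ge0.
  have := mulr_ge0 xy0 (addr_ge0 (addr_ge0 (sqr_ge0 x) xy0) (sqr_ge0 y)).
  have := h x; have := h y; lra.
(* With s = x + y <= 0 the bounds leave 8 + 22.82 s + 17.25 s^2 >= 17.25 (s + 2/3)^2 + 1/3. *)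
have := sqr_ge0 (x + y + 2 / 3); lra.
Qed.

(* Splitting off the vertex of the path at which the centre of the star is
   attached, I(w) = (1 + 3w + w^2)((1+w)^3 + w) + w(1 + 2w)(1+w)^3. With
   r = |w|, a = |1+w| and b = |1+2w| >= a - r, a root satisfies
   (b - ra)(a^3 - r) <= rba^3; the resulting inequality in a and r is the
   weakest for a = 1 - r, where it reads I(-r) <= 0. *)
Lemma starred_path_root_norm (R : realType) (w : R[i]) :
  let r := Normc.normc w in
  root (indep_poly R[i] starred_path) w -> r <= 26 / 100 ->
  (indep_poly R starred_path).[- r] <= 0.
Proof.
move=> r; rewrite /root !horner_starred_path => /eqP rw rle.
pose p3 := (1 + w + w) + w * (1 + w).
pose s := (1 + w) ^+ 3 + w.
have e : p3 * s = - (w * (1 + w + w) * (1 + w) ^+ 3).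
  by apply/eqP; rewrite -subr_eq0 opprK -rw /p3 /s; apply/eqP; ring.
have {e} := congr1 (@Normc.normc R) e.
rewrite normc_opp !Normc.normcM -/r.
have := lerB_normcD (1 + w + w) (w * (1 + w)).
have := lerB_normcD ((1 + w) ^+ 3) w.
have := lerB_normcD (1 + w) w; have := lerB_normcD 1 w.
rewrite -/p3 -/s !Normc.normcM Normc.normc1 -/r.
have : 0 <= r by apply: normc_ge0.
move: (Normc.normc p3) (Normc.normc s).
move: (Normc.normc (1 + w)) (Normc.normc (1 + w + w)).
move: r rle {rw p3 s} => r rle a b P S r0 ar ba Sa Pb e.
set c := 1 - r in ar.
have c1 : 74 / 100 <= c by rewrite /c; lra.
have c2 : 54 / 100 <= c ^+ 2 by nra.
have a2 : c ^+ 2 <= a ^+ 2 by nra.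
have a3 : 39 / 100 <= a ^+ 3 by rewrite exprS; nra.
have S0 : 0 <= a ^+ 3 - r by lra.
have br : 0 <= b - r * a by nra.
have PS : (b - r * a) * (a ^+ 3 - r) <= r * b * a ^+ 3.
  rewrite [r * b * _](_ : _ = P * S); last by rewrite e; ring.
  by apply: ler_pM.
have k1 : 0 <= a ^+ 3 * (1 - r) - r by nra.
(* [PS] rearranges to b (a^3 (1 - r) - r) <= r a (a^3 - r), and by [k1] b can be lowered to a -
   r. *)
have g : (a - r) * (a ^+ 3 * (1 - r) - r) <= r * a * (a ^+ 3 - r).
  have : (a - r) * (a ^+ 3 * (1 - r) - r) <= b * (a ^+ 3 * (1 - r) - r).
    by apply: ler_wpM2r.
  lra.
(* Let D(a) be the left side of [g] minus the right. Then D(c) = I(-r), and [B] is (D(a) - D(c)) /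
   (a - c); so [B >= 0] gives I(-r) <= D(a) <= 0. *)
pose q := a ^+ 2 + a * c + c ^+ 2.
pose B := (1 - 2 * r) * (a ^+ 3 + a * c * (a + c) + c ^+ 3)
          - r * (1 - r) * q - r * (1 - r).
have q0 : 162 / 100 <= q by rewrite /q; nra.
have rr : r * (1 - r) <= 20 / 100 by nra.
have cub : 74 / 100 * q <= a ^+ 3 + a * c * (a + c) + c ^+ 3.
  have -> : a ^+ 3 + a * c * (a + c) + c ^+ 3 = a * q + c ^+ 3 by rewrite /q; ring.
  have : 74 / 100 * q <= a * q by apply: ler_wpM2r; lra.
  have : 0 <= c ^+ 3 by apply: exprn_ge0; lra.
  lra.
have B0 : 0 <= B by rewrite /B; nra.
have : 0 <= (a - c) * B by apply: mulr_ge0 => //; lra.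
have -> : (a - c) * B =
    (a - r) * (a ^+ 3 * (1 - r) - r) - r * a * (a ^+ 3 - r)
    - (1 + 8 * (- r) + 21 * (- r) ^+ 2 + 23 * (- r) ^+ 3
       + 13 * (- r) ^+ 4 + 3 * (- r) ^+ 5).
  by rewrite /B /q /c; ring.
lra.
Qed.

(** A root of modulus r < -z would give I(-r) <= 0, yet I increases strictly from I(z) = 0 to
    I(-r). *)
Lemma smallest_root_starred_path (R : realType) : exists2 z : R,
  z < - 4^-1 & smallest_modulus_root starred_path z.
Proof.
pose p := indep_poly R starred_path.
have p4 : 0 < p.[- 4^-1] by rewrite /p horner_starred_path; lra.
(* I(-1/4) = 1/1024 is tiny, so the sign changes just below -1/4, well within the range where I is
   increasing. *)
have [||z /andP[z1 z2] rz] := @poly_ivt R p (- (251 / 1000)) (- 4^-1).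
- by lra.
- by rewrite (ltW p4) andbT /p horner_starred_path; lra.
have z4 : z < - 4^-1.
  rewrite lt_neqAle z2 andbT; apply: contraTneq p4 => <-.
  by rewrite (rootP rz) ltxx.
exists z => //; apply/smallest_rootP; split=> //; first by lra.
move=> w rw; rewrite leNgt; apply/negP => wz.
have := starred_path_root_norm rw; set r := Normc.normc w in wz *.
have r0 : 0 <= r by apply: normc_ge0.
have := @starred_path_poly_incr R z (- r).
rewrite (rootP rz) => h1 h2.
have : (indep_poly R starred_path).[- r] <= 0 by apply: h2; lra.
by rewrite leNgt h1 //; lra.
Qed.

(** * Induction on k through coronas *)

Theorem theorem4p6 (R : realType) (k : nat) :
  exists T1 T2 : sgraph,
    [/\ is_tree T1 /\ graph_order T1 = (2 ^ (k + 3))%N,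
        is_tree T2 /\ graph_order T2 = (2 ^ (k + 3))%N,
        ~ preceq R T1 T2
      & ~ preceq R T2 T1].
Proof.
(* The induction also carries the smallest-modulus roots, whose existence [preceq_corona]
   requires. *)
suff [T1 [T2 [z1 [z2 [h1 h2 [t1 o1] [t2 o2] n12]]]]] : exists T1 T2 (z1 z2 : R),
    [/\ smallest_modulus_root T1 z1, smallest_modulus_root T2 z2,
        is_tree T1 /\ graph_order T1 = (2 ^ (k + 3))%N,
        is_tree T2 /\ graph_order T2 = (2 ^ (k + 3))%N
      & ~ preceq R T1 T2 /\ ~ preceq R T2 T1].
  by exists T1, T2; case: n12.
elim: k => [|k [T1 [T2 [z1 [z2 [h1 h2 [t1 o1] [t2 o2] [n12 n21]]]]]]].
  have [z z4 hz] := smallest_root_starred_path R.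
  exists comb8, starred_path, (- 4^-1), z.
  split=> //; first exact: smallest_root_comb8.
  - by split; [apply: comb8_tree|apply: order_comb8].
  - by split; [apply: starred_path_tree|apply: order_starred_path].
  split=> [/(_ (- 4^-1))|/(_ (- 5^-1))].
  - rewrite (xiE hz) (rootP (smallest_root_comb8 R).1) horner_starred_path.
    have -> : z <= (- 4^-1 : R) <= 0 by lra.
    by move=> /(_ isT); lra.
  - rewrite (xiE (smallest_root_comb8 R)) horner_comb8_at horner_starred_path.
    have -> : - 4^-1 <= (- 5^-1 : R) <= 0 by lra.
    by move=> /(_ isT); lra.
exists (corona T1), (corona T2), (z1 / (1 - z1)), (z2 / (1 - z2)).
split; try exact: smallest_root_corona.
- by split; [apply: pendant_tree|rewrite order_corona o1 addSn expnS].
- by split; [apply: pendant_tree|rewrite order_corona o2 addSn expnS].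
split.
- by move/(preceq_corona h2); rewrite o1 o2 => /(_ erefl).
- by move/(preceq_corona h1); rewrite o1 o2 => /(_ erefl).
Qed.
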